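(* Let $m=4+12q$ with $q=10+16d$ for a nonnegative integer $d$. The minimal decomposition of $\mathbb{Z}_2$ for the Fibonacci polynomial $F_m$ is $$\mathbb{Z}_2=\{0\}\sqcup\Bigl(\bigcup_{k=0}^{2^5-1}M_k\Bigr)\sqcup(2\mathbb{Z}_2-\{0\}),$$ where $M_k=(1+4k+2^7\mathbb{Z}_2)\cup(51+116k+48k^2+2^7\mathbb{Z}_2)$. Here $\{0\}$ is the set of a fixed point, the $M_k$'s are the minimal components, and the set $2\mathbb{Z}_2-\{0\}$ is the attracting basin of the fixed point $0$.
   Context: $\mathbb{Z}_2$ is the ring of 2-adic integers with the 2-adic metric. The Fibonacci polynomials are defined by $F_0(x)=0$, $F_1(x)=1$, $F_m(x)=xF_{m-1}(x)+F_{m-2}(x)$ for $m\ge 2$. For a polynomial $f$ over $\mathbb{Z}_2$, a minimal decomposition of $\mathbb{Z}_2$ for $f$ is a decomposition $\mathbb{Z}_2=\mathcal P\sqcup\mathcal M\sqcup\mathcal B$ (some parts possibly empty) in which: $\mathcal P$ is the finite set consisting of all periodic points of $f$; $\mathcal M=\bigsqcup_i\mathcal M_i$ is the union of all (at most countably many) clopen $f$-invariant sets $\mathcal M_i$ (the minimal components), each a finite union of balls, such that each $f:\mathcal M_i\to\mathcal M_i$ is minimal (every orbit is dense in $\mathcal M_i$); and each point of $\mathcal B$ lies in the attracting basin of a periodic orbit or of a minimal subsystem. A point $x$ lies in the attracting basin of a set $C$ (a periodic orbit or minimal component) if the distance from $f^n(x)$ to $C$ tends to $0$ as $n\to\infty$;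 when a part $\mathcal B$ of a decomposition is said to be the attracting basin of $C$, this means every point of $\mathcal B$ lies in the attracting basin of $C$ (the points of $C$ being listed separately). *)

(* Defs.v *)
From HB Require Import structures.
From mathcomp Require Import all_boot all_order all_algebra.
From mathcomp Require Import all_classical all_reals all_analysis.
From mathcomp Require Import Rstruct Rstruct_topology.

Set Implicit Arguments.
Unset Strict Implicit.
Unset Printing Implicit Defensive.

Import Order.TTheory GRing.Theory Num.Theory.
Import numFieldNormedType.Exports.

Local Open Scope classical_set_scope.
Local Open Scope ring_scope.

(* Z_2 as the inverse limit of the Z/2^n: [res x n] is the representative of
   x modulo 2^n in {0, ..., 2^n - 1} (the bound follows from [resP]). *)
Record Z2 := MkZ2 {
  res : nat -> nat ;
  resP : forall n, res n = (res n.+1 %% 2 ^ n)%N }.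

Lemma Z2_ext (x y : Z2) : (forall n, res x n = res y n) -> x = y.
Proof.
case: x y => [f fP] [g gP] /= fg.
have efg : f = g by apply/funext.
by rewrite -efg in gP *; congr MkZ2; exact: Prop_irrelevance.
Qed.

Lemma res_mod (x : Z2) n : (res x n %% 2 ^ n)%N = res x n.
Proof. by rewrite {1}resP modn_mod -resP. Qed.

Lemma resS (x : Z2) n : res x n.+1 = res x n %[mod 2 ^ n].
Proof. by rewrite -resP res_mod. Qed.

Definition Z2_of (f : nat -> nat)
  (fP : forall n, f n.+1 = f n %[mod 2 ^ n]) : Z2.
Proof.
exists (fun n => f n %% 2 ^ n)%N => n.
by rewrite modn_dvdm ?dvdn_exp2l.
Defined.

HB.instance Definition _ := gen_eqMixin Z2.
HB.instance Definition _ := gen_choiceMixin Z2.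

Lemma Z2_add_subproof (x y : Z2) n :
  (res x n.+1 + res y n.+1 = res x n + res y n %[mod 2 ^ n])%N.
Proof. by rewrite -modnDm !resS modnDm. Qed.

Lemma Z2_mul_subproof (x y : Z2) n :
  (res x n.+1 * res y n.+1 = res x n * res y n %[mod 2 ^ n])%N.
Proof. by rewrite -modnMm !resS modnMm. Qed.

Lemma res_lt (x : Z2) n : (res x n < 2 ^ n)%N.
Proof. by rewrite -res_mod ltn_mod expn_gt0. Qed.

Lemma Z2_opp_subproof (x : Z2) n :
  (2 ^ n.+1 - res x n.+1 = 2 ^ n - res x n %[mod 2 ^ n])%N.
Proof.
apply/eqP; rewrite -(eqn_modDr (res x n)) subnK; last exact/ltnW/res_lt.
rewrite -modnDmr -resS modnDmr subnK; last exact/ltnW/res_lt.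
by rewrite expnS modnMl modnn.
Qed.

Definition Z2_add x y := Z2_of (Z2_add_subproof x y).
Definition Z2_mul x y := Z2_of (Z2_mul_subproof x y).
Definition Z2_opp x := Z2_of (Z2_opp_subproof x).
Definition Z2_nat (k : nat) := @Z2_of (fun=> k) (fun=> erefl).

Lemma Z2_addA : associative Z2_add.
Proof. by move=> x y z; apply: Z2_ext => n /=; rewrite modnDml modnDmr addnA. Qed.

Lemma Z2_addC : commutative Z2_add.
Proof. by move=> x y; apply: Z2_ext => n /=; rewrite addnC. Qed.

Lemma Z2_add0 : left_id (Z2_nat 0) Z2_add.
Proof. by move=> x; apply: Z2_ext => n /=; rewrite mod0n add0n res_mod. Qed.

Lemma Z2_addN : left_inverse (Z2_nat 0) Z2_opp Z2_add.
Proof.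
move=> x; apply: Z2_ext => n /=.
by rewrite modnDml subnK ?modnn ?mod0n //; exact/ltnW/res_lt.
Qed.

HB.instance Definition _ :=
  GRing.isZmodule.Build Z2 Z2_addA Z2_addC Z2_add0 Z2_addN.

Lemma Z2_mulA : associative Z2_mul.
Proof. by move=> x y z; apply: Z2_ext => n /=; rewrite modnMml modnMmr mulnA. Qed.

Lemma Z2_mulC : commutative Z2_mul.
Proof. by move=> x y; apply: Z2_ext => n /=; rewrite mulnC. Qed.

Lemma Z2_mul1 : left_id (Z2_nat 1) Z2_mul.
Proof. by move=> x; apply: Z2_ext => n /=; rewrite modnMml mul1n res_mod. Qed.

Lemma Z2_mulD : left_distributive Z2_mul Z2_add.
Proof.
by move=> x y z; apply: Z2_ext => n /=; rewrite modnMml modnDm mulnDl.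
Qed.

Lemma Z2_1neq0 : Z2_nat 1 != 0 :> Z2.
Proof. by apply/eqP => /(congr1 (res ^~ 1%N)). Qed.

HB.instance Definition _ :=
  GRing.Zmodule_isComNzRing.Build Z2 Z2_mulA Z2_mulC Z2_mul1 Z2_mulD Z2_1neq0.

Lemma res0 n : res 0 n = 0%N.
Proof. exact: mod0n. Qed.

Lemma resD (x y : Z2) n : res (x + y) n = ((res x n + res y n) %% 2 ^ n)%N.
Proof. by []. Qed.

Lemma resM (x y : Z2) n : res (x * y) n = ((res x n * res y n) %% 2 ^ n)%N.
Proof. by []. Qed.

Lemma resN (x : Z2) n : res (- x) n = ((2 ^ n - res x n) %% 2 ^ n)%N.
Proof. by []. Qed.

Notation R := Rdefinitions.R.

(* The 2-adic absolute value: for x <> 0, the least n such that 2^(n+1) does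
   not divide x is the 2-adic valuation of x. *)
Definition abs2 (x : Z2) : R :=
  if pselect (exists n, res x n.+1 != 0%N) is left x_neq0
  then 2 ^- (ex_minn x_neq0) else 0.

Lemma res_eq0_le (x : Z2) m n : (m <= n)%N -> res x n = 0%N -> res x m = 0%N.
Proof.
move=> /subnKC <-; elim: (n - m)%N => [|k IHk]; first by rewrite addn0.
by rewrite addnS => x0; apply: IHk; rewrite resP x0 mod0n.
Qed.

Variant abs2_spec (x : Z2) : R -> Prop :=
| Abs2Zero of x = 0 : abs2_spec x 0
| Abs2Pow n of res x n = 0%N & res x n.+1 != 0%N : abs2_spec x (2 ^- n).

Lemma abs2P (x : Z2) : abs2_spec x (abs2 x).
Proof.
rewrite /abs2; case: pselect => [ex|nex].
  case: ex_minnP => n xn nmin; constructor => //.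
  case: n nmin {xn} => [|n] nmin; first by rewrite resP modn1.
  by apply/eqP/negPn/negP => /nmin; rewrite ltnn.
constructor; apply: Z2_ext => n; rewrite res0.
apply: (res_eq0_le (leqnSn n)); apply/eqP/negPn/negP => xn.
by apply: nex; exists n.
Qed.

Lemma abs2_ge0 (x : Z2) : 0 <= abs2 x.
Proof. by case: abs2P => // n _ _; rewrite invr_ge0 exprn_ge0. Qed.

Lemma abs2_le (x : Z2) n : (abs2 x <= 2 ^- n) = (res x n == 0%N).
Proof.
case: abs2P => [->|k xk xSk]; first by rewrite res0 eqxx invr_ge0 exprn_ge0.
rewrite lef_pV2 ?posrE ?exprn_gt0// ler_eXn2l ?ltr1n//.
apply/idP/eqP => [nk|xn]; first exact: res_eq0_le nk xk.
by rewrite leqNgt; apply: contra xSk => kn; apply/eqP; exact: res_eq0_le kn xn.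
Qed.

Lemma abs2_eq0 (x : Z2) : abs2 x = 0 -> x = 0.
Proof.
case: abs2P => // n _ _ /eqP.
by rewrite invr_eq0 expf_eq0 pnatr_eq0 andbF.
Qed.

Lemma abs20 : abs2 0 = 0.
Proof. by case: abs2P => // n _; rewrite res0. Qed.

Lemma abs2_max (x y : Z2) : abs2 (x + y) <= Num.max (abs2 x) (abs2 y).
Proof.
wlog xy : x y / abs2 x <= abs2 y => [H|].
  have /orP[/H//|/H] := le_total (abs2 x) (abs2 y).
  by rewrite addrC maxC.
rewrite max_r//; move: xy; case: (abs2P y) => [->|n yn _].
  by rewrite addr0.
by rewrite !abs2_le resD yn => /eqP ->; rewrite mod0n.
Qed.

Lemma abs2N (x : Z2) : abs2 (- x) = abs2 x.
Proof.
suff H y : abs2 (- y) <= abs2 y.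
  by apply: le_anti; rewrite H -{1}[x]opprK H.
case: (abs2P y) => [->|n yn _]; first by rewrite oppr0 abs20.
by rewrite abs2_le resN yn subn0 modnn.
Qed.

Definition dist2 (x y : Z2) : R := abs2 (x - y).

Lemma dist2xx x : dist2 x x = 0.
Proof. by rewrite /dist2 subrr abs20. Qed.

Lemma dist2_positivity x y : dist2 x y = 0 -> x = y.
Proof. by move/abs2_eq0/eqP; rewrite subr_eq0 => /eqP. Qed.

Lemma dist2_sym x y : dist2 x y = dist2 y x.
Proof. by rewrite /dist2 -abs2N opprB. Qed.

Lemma dist2_triangle y x z : dist2 x z <= dist2 x y + dist2 y z.
Proof.
rewrite /dist2 -(subrKA y); apply: (le_trans (abs2_max _ _)).
by rewrite ge_max lerDl lerDr !abs2_ge0.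
Qed.

HB.instance Definition _ :=
  isMetric.Build R Z2 dist2xx dist2_positivity dist2_sym dist2_triangle.

Fixpoint fib_poly (A : nzRingType) (m : nat) : {poly A} :=
  match m with
  | 0 => 0
  | m1.+1 => match m1 with
             | 0 => 1
             | m2.+1 => 'X * fib_poly A m1 + fib_poly A m2
             end
  end.

Section Dynamics.
Variables (K : realType) (T : metricType K).
Implicit Types (f : T -> T) (x : T) (A C N P B : set T).

Definition forward_orbit f x : set T := [set iter n f x | n in [set: nat]].

Definition periodic f x : Prop := exists2 n, (0 < n)%N & iter n f x = x.

Definition periodic_orbit f C : Prop :=
  exists2 x, periodic f x & C = forward_orbit f x.

Definition finite_union_of_balls N : Prop :=
  exists2 s : seq (T * K), (forall b, b \in s -> 0 < b.2) &
    N = \bigcup_(b in [set` s]) ball b.1 b.2.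

(* Nonemptiness is needed because set0 would satisfy all the other clauses. *)
Record minimal_component f N : Prop := {
  mc_nonempty : N !=set0 ;
  mc_clopen : clopen N ;
  mc_balls : finite_union_of_balls N ;
  mc_invariant : f @` N `<=` N ;
  mc_minimal : forall x, N x -> N `<=` closure (forward_orbit f x) }.

Definition attracting_basin f C : set T :=
  [set x | edist_inf C (iter n f x) @[n --> \oo] --> 0%E].

Record minimal_decomposition f P (I : Type) (D : set I) (M : I -> set T) B
    : Prop := {
  md_cover : P `|` \bigcup_(i in D) M i `|` B = setT ;
  md_disjPM : P `&` \bigcup_(i in D) M i = set0 ;
  md_disjPB : P `&` B = set0 ;
  md_disjMB : \bigcup_(i in D) M i `&` B = set0 ;
  md_finite : finite_set P ;
  md_periodic : P = [set x | periodic f x] ;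
  md_countable : countable D ;
  md_trivIset : trivIset D M ;
  md_components : [set M i | i in D] = [set N | minimal_component f N] ;
  md_basin : forall x, B x -> exists2 C,
    periodic_orbit f C \/ minimal_component f C & attracting_basin f C x }.

End Dynamics.

Arguments attracting_basin K {T}.
Arguments minimal_component K {T}.
Arguments minimal_decomposition K {T} f P {I}.

Definition Z2_coset (a : Z2) (n : nat) : set Z2 :=
  [set a + 2 ^+ n * z | z in [set: Z2]].

(* Main.v *)
From Stdlib Require Import NArith.
Require Import Defs.
From mathcomp Require Import all_boot all_order all_algebra.
From mathcomp Require Import all_classical all_reals all_analysis.
From mathcomp Require Import Rstruct Rstruct_topology.
From mathcomp Require Import ring zify.

(** Write F for the Fibonacci polynomial F_m with m = 124 + 192 d, seen as a
self-map of the 2-adic integers. The even and the odd integers are treated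
separately.

Even integers. F vanishes at 0 because m is even, and F'(0) is even because
F(2) is divisible by 4; by Taylor expansion at 0, F therefore raises the
valuation of every even integer by at least one ([contract_horner]). So even
orbits converge to 0, no other even point is periodic, and a minimal component
cannot meet the even integers: being closed it would contain 0, by minimality
it would be {0}, and {0} is not open ([contract_minimal]).

Odd integers. Two facts drive the dynamics.
- F is steady: modulo 2^(n+2), the displacement F(x) - x depends only on x
  modulo 2^n, for n >= 2. This is Taylor expansion together with F' = 1 mod 4 at
  odd points, and the latter follows from F(x + 4) = F(x) + 4 mod 16
  ([steady_horner]).
- F o F moves every odd point by exactly 2^7 modulo 2^8.
Let g be steady and move every odd point by 2^n modulo 2^(n+1), with n >= 2.
The two steps of g o g then have displacements that agree modulo 2^(n+2), so g
o g moves every odd point by 2^(n+1) modulo 2^(n+2) ([shifts_double]). By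
induction g^(2^j) moves points by 2^(n+j) modulo 2^(n+j+1). Hence an orbit of g
that agrees with y modulo 2^n can be corrected one binary digit at a time and
comes arbitrarily close to y ([shifts_dense]), and g has no periodic point
among the odd integers ([shifts_aperiodic]). With g = F o F and n = 7, each
ball of radius 2^(-7) of odd integers is minimal for F o F.

Since F(x) = - x mod 4, F exchanges the classes 1 and 3 modulo 4, so the balls
are paired by F: M_k is the set of odd x such that x or F(x) is 1 + 4k modulo
2^7 ([component_fibE]). Each M_k is minimal, and these sets partition the odd
integers; every minimal component meets one of them, hence equals it.

What remains is finite: the values of F modulo 2^8 at odd points. The pair
(F_m, F_(m+1)) modulo 2^8 has period 384 in m at each odd residue, so only the
parity of d matters and the values are computed by running the Fibonacci
recurrence. *)

Set Implicit Arguments.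
Unset Strict Implicit.
Unset Printing Implicit Defensive.

Import Order.TTheory GRing.Theory Num.Theory.

Local Open Scope classical_set_scope.
Local Open Scope ring_scope.

(** * Residues and divisibility by powers of 2 *)

Lemma res_modn (x : Z2) k n : (k <= n)%N -> (res x n %% 2 ^ k)%N = res x k.
Proof.
move=> /subnKC <-; elim: (n - k)%N => [|j IHj]; first by rewrite addn0 res_mod.
by rewrite -IHj addnS (resP x (k + j)) modn_dvdm// dvdn_exp2l// leq_addr.
Qed.

Lemma res_eq_le (x y : Z2) k n :
  (k <= n)%N -> res x n = res y n -> res x k = res y k.
Proof. by move=> kn xy; rewrite -(res_modn x kn) xy res_modn. Qed.

Lemma res_natr k n : res (k%:R : Z2) n = (k %% 2 ^ n)%N.
Proof.
elim: k => [|k IHk]; first by rewrite mulr0n res0 mod0n.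
by rewrite mulrS resD IHk modnDm add1n.
Qed.

Lemma res_pow2M n (z : Z2) k : res (2 ^+ n * z) (n + k) = (2 ^ n * res z k)%N.
Proof.
rewrite -natrX resM res_natr modnMml expnD -muln_modr.
by rewrite res_modn ?leq_addl.
Qed.

(** The quotient by 2 ^ n is built digit by digit, by dividing the residues
    modulo 2 ^ (n + k). *)
Lemma res_eq0P (x : Z2) n : res x n = 0%N -> exists z, x = 2 ^+ n * z.
Proof.
move=> x0.
have dvdx k : (2 ^ n %| res x (n + k))%N.
  by rewrite /dvdn res_modn ?leq_addr ?x0.
have zP k : (res x (n + k.+1) %/ 2 ^ n = res x (n + k) %/ 2 ^ n %[mod 2 ^ k])%N.
  have := res_modn x (leq_addr 1 (n + k)).
  rewrite -addnA addn1 -{1}(divnK (dvdx k.+1)) -{1}(divnK (dvdx k)).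
  rewrite expnD mulnC -muln_modr mulnC => /eqP.
  by rewrite eqn_pmul2r ?expn_gt0// => /eqP <-; rewrite modn_mod.
exists (Z2_of zP); apply: Z2_ext => k.
apply: (res_eq_le (leq_addl n k)).
rewrite res_pow2M /= modn_small; first by rewrite mulnC divnK.
by rewrite ltn_divLR ?expn_gt0// mulnC -expnD res_lt.
Qed.

Lemma res_subr_eq0 (x y : Z2) n : (res (x - y) n = 0%N) <-> (res x n = res y n).
Proof.
split=> [xy|xy]; last by rewrite resD xy -resD subrr res0.
by rewrite -(subrK y x) resD xy add0n res_mod.
Qed.

Lemma res_eqP (x y : Z2) n :
  res x n = res y n -> exists z, x = y + 2 ^+ n * z.
Proof.
by move=> /res_subr_eq0/res_eq0P [z xyz]; exists z; rewrite -xyz addrC subrK.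
Qed.

Lemma res_pow2M0 n (z : Z2) : res (2 ^+ n * z) n = 0%N.
Proof. by have := res_pow2M n z 0; rewrite addn0 (resP z) modn1 muln0. Qed.

Lemma res_addpow2M (y z : Z2) n : res (y + 2 ^+ n * z) n = res y n.
Proof. by rewrite resD res_pow2M0 addn0 res_mod. Qed.

Lemma Z2_cosetE a n : Z2_coset a n = [set x | res x n = res a n].
Proof.
apply/seteqP; split=> [x [z _ <-]/=|x /res_eqP [z ->]].
  exact: res_addpow2M.
by exists z.
Qed.

Lemma res1_cases (x : Z2) : res x 1 = 0%N \/ res x 1 = 1%N.
Proof. by have := res_lt x 1; case: (res x 1) => [|[|]]//; [left|right]. Qed.

Lemma even_setE : [set 2 * z | z in [set: Z2]] = [set x | res x 1 = 0%N].
Proof.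
apply/seteqP; split=> [x [z _ <-]/=|x /res_eq0P[z ->]]; last by exists z.
exact: (res_pow2M0 1 z).
Qed.

(** * The 2-adic topology through residues *)

(** Distances take only the values 0 and 2 ^- k, so the open ball of radius
    2 ^- n is the closed ball of radius 2 ^- n.+1. *)
Lemma mdist_lt_pow2 (x y : Z2) n :
  (mdist x y < 2 ^- n) <-> (res x n.+1 = res y n.+1).
Proof.
rewrite -[mdist x y]/(abs2 (x - y)); rewrite -res_subr_eq0.
case: abs2P => [->|k xk xSk].
  by rewrite res0 invr_gt0 exprn_gt0.
rewrite ltf_pV2 ?posrE ?exprn_gt0// ltr_eXn2l ?ltr1n//.
split=> [nk|]; first exact: res_eq0_le nk xk.
move=> xn; rewrite ltnNge; apply: contra xSk => kn.
by apply/eqP; exact: res_eq0_le xn.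
Qed.

Lemma ball_pow2E (x : Z2) n :
  ball x (2 ^- n : R) = [set y | res y n.+1 = res x n.+1].
Proof.
rewrite ballEmdist; apply/seteqP.
by split=> y /= => [/mdist_lt_pow2->//|xy]; apply/mdist_lt_pow2.
Qed.

Lemma nbhs_Z2P (x : Z2) (A : set Z2) :
  nbhs x A <-> exists n, [set y | res y n = res x n] `<=` A.
Proof.
split=> [/nbhs_ballP [e /= e0 eA]|[n nA]].
  have [N _ /(_ N (leqnn N)) Ne] :=
    near_infty_natSinv_expn_lt (PosNum e0).
  exists N.+1 => y yN; apply: eA.
  have : ball x (2 ^- N : R) y by rewrite ball_pow2E.
  by apply: le_ball; rewrite -div1r ltW.
apply/nbhs_ballP; exists (2 ^- n) => /=; first by rewrite invr_gt0 exprn_gt0.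
by rewrite ball_pow2E => y yx; apply: nA; apply: res_eq_le yx.
Qed.

Lemma closure_Z2P (A : set Z2) (x : Z2) :
  closure A x <-> forall n, exists2 a, A a & res a n = res x n.
Proof.
split=> [clA n|h B /nbhs_Z2P [n nB]].
  by have [|a [Aa ax]] := clA [set y | res y n = res x n];
    [apply/nbhs_Z2P; exists n|exists a].
by have [a Aa ax] := h n; exists a; split=> //; apply: nB.
Qed.

Lemma clopen_res n (P : set nat) : clopen [set x : Z2 | P (res x n)].
Proof.
split; first by rewrite openE => x Px; apply/nbhs_Z2P; exists n => y /= ->.
by move=> x /closure_Z2P/(_ n) [a Pa ax]; rewrite /= -ax.
Qed.
(** * Dynamics on the odd 2-adic integers *)

(* Simplification would otherwise unfold the residue of a sum or a product. *)
Local Arguments res _%_ring_scope _%_nat_scope : simpl never.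

Definition odd_stable (h : Z2 -> Z2) :=
  forall x, res x 1 = 1%N -> res (h x) 1 = 1%N.

(** For a polynomial this says that the derivative is 1 modulo 4 at odd points;
    phrased with displacements it is stable under composition. *)
Definition steady (h : Z2 -> Z2) := forall n x y, (2 <= n)%N ->
  res x 1 = 1%N -> res x n = res y n ->
  res (h x - x) n.+2 = res (h y - y) n.+2.

Definition shifts n (h : Z2 -> Z2) :=
  forall x, res x 1 = 1%N -> res (h x - x) n.+1 = (2 ^ n)%N.

Lemma odd_res_eq (x y : Z2) n : (0 < n)%N ->
  res x n = res y n -> res x 1 = 1%N -> res y 1 = 1%N.
Proof. by move=> n0 /(res_eq_le n0) <-. Qed.

Lemma steady_lipschitz h n x y : steady h -> (2 <= n)%N -> res x 1 = 1%N ->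
  res x n = res y n -> res (h x) n = res (h y) n.
Proof.
move=> sh n2 x1 xy; rewrite -(subrK x (h x)) -(subrK y (h y)) !resD xy.
congr ((_ + _) %% _)%N; rewrite -!resD.
by apply: (@res_eq_le _ _ _ n.+2); [rewrite ltnW|exact: sh].
Qed.

(** The displacement of a composite is the sum of the two displacements, and a
    steady map preserves congruences modulo 2 ^ n. *)
Lemma steady_comp h1 h2 : odd_stable h2 -> steady h1 -> steady h2 ->
  steady (h1 \o h2).
Proof.
move=> o2 s1 s2 n x y n2 x1 xy /=.
rewrite -(subrKA (h2 x) (h1 (h2 x))) -(subrKA (h2 y) (h1 (h2 y))).
rewrite !(resD (_ - _)).
congr ((_ + _) %% _)%N; last exact: s2.
by apply: s1 => //; [exact: o2|exact: steady_lipschitz].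
Qed.

Lemma iter_odd_stable h i : odd_stable h -> odd_stable (iter i h).
Proof. by move=> oh x x1; elim: i => //= i; exact: oh. Qed.

Lemma iter_steady h i : odd_stable h -> steady h -> steady (iter i h).
Proof.
move=> oh sh; elim: i => [n x y _ _ _|i IHi]; first by rewrite /= !subrr.
by apply: (@steady_comp h (iter i h)) => //; exact: iter_odd_stable.
Qed.

Lemma res_eq_shift h n x : shifts n h -> res x 1 = 1%N -> res (h x) n = res x n.
Proof.
move=> sh x1; apply/res_subr_eq0; rewrite -(res_modn _ (leqnSn n)) sh//.
by rewrite modnn.
Qed.

Lemma shifts_iter h n i x : odd_stable h -> shifts n h -> res x 1 = 1%N ->
  res (iter i h x - x) n.+1 = (i * 2 ^ n %% 2 ^ n.+1)%N.
Proof.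
move=> oh sh x1; elim: i => [|i IHi]; first by rewrite subrr res0 mod0n.
rewrite /= -(subrKA (iter i h x)) resD IHi sh; last exact: iter_odd_stable.
by rewrite modnDmr mulSn.
Qed.

(** The two successive displacements start from points that agree modulo 2 ^ n,
    so by steadiness they agree modulo 2 ^ n.+2 and their sum is twice the
    first one. *)
Lemma shifts_double h n : odd_stable h -> steady h -> (2 <= n)%N ->
  shifts n h -> shifts n.+1 (h \o h).
Proof.
move=> oh sh n2 hn x x1 /=.
rewrite -(subrKA (h x)) resD.
rewrite (sh n (h x) x n2); [|exact: oh|exact: res_eq_shift].
have dE : (res (h x - x) n.+2 %% 2 ^ n.+1 = 2 ^ n)%N by rewrite res_modn ?hn.
have {dE} [c ->] : exists c, res (h x - x) n.+2 = (c * 2 ^ n.+1 + 2 ^ n)%N.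
  by exists (res (h x - x) n.+2 %/ 2 ^ n.+1)%N; rewrite -dE -divn_eq.
have -> : (c * 2 ^ n.+1 + 2 ^ n + (c * 2 ^ n.+1 + 2 ^ n) =
          c * 2 ^ n.+2 + 2 ^ n.+1)%N by rewrite !expnS; lia.
by rewrite modnMDl modn_small// ltn_exp2l.
Qed.

Lemma shifts_pow2 h n j : odd_stable h -> steady h -> (2 <= n)%N ->
  shifts n h -> shifts (n + j) (iter (2 ^ j) h).
Proof.
move=> oh sh n2 hn; elim: j => [|j IHj]; first by rewrite addn0.
rewrite addnS expnS mul2n -addnn => x x1; rewrite iterD.
apply: (@shifts_double (iter (2 ^ j) h)) => //.
- exact: iter_odd_stable.
- exact: iter_steady.
- exact: leq_trans (leq_addr _ _).
Qed.

(** If the orbit has reached y modulo 2 ^ (n + k) but not modulo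
    2 ^ (n + k).+1, then 2 ^ k further steps change exactly the wrong digit. *)
Lemma shifts_dense h n x y : odd_stable h -> steady h -> (2 <= n)%N ->
  shifts n h -> res x 1 = 1%N -> res x n = res y n ->
  forall k, exists i, res (iter i h x) k = res y k.
Proof.
move=> oh sh n2 hn x1 xy k.
suff [i] : exists i, res (iter i h x) (n + k) = res y (n + k).
  by move=> /(res_eq_le (leq_addl n k)) ?; exists i.
elim: k => [|k [i IHk]]; first by exists 0%N; rewrite addn0.
set x' := iter i h x in IHk *.
have x'1 : res x' 1 = 1%N by exact: iter_odd_stable.
have [e|ne] := eqVneq (res x' (n + k.+1)) (res y (n + k.+1)); first by exists i.
exists (2 ^ k + i)%N; rewrite iterD -/x'.
have /= sk := shifts_pow2 k oh sh n2 hn x'1.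
have [z yx'] := res_eqP (esym IHk).
have z1 : res z 1 = 1%N.
  have [z0|//] := res1_cases z; case/eqP: ne; rewrite addnS yx' resD.
  by rewrite -(addn1 (n + k)) res_pow2M z0 muln0 addn0 res_mod.
rewrite addnS -(subrK x' (iter _ h x')) resD sk yx' [RHS]resD.
by rewrite -(addn1 (n + k)) res_pow2M z1 muln1 addnC.
Qed.

(** With p = s * 2 ^ j and s odd, p steps move a point by s * 2 ^ (n + j), which
    is nonzero modulo 2 ^ (n + j).+1. *)
Lemma shifts_aperiodic h n x p : odd_stable h -> steady h -> (2 <= n)%N ->
  shifts n h -> res x 1 = 1%N -> (0 < p)%N -> iter p h x <> x.
Proof.
move=> oh sh n2 hn x1 p0 px.
have [j [s [s1 pE]]] : exists j s, odd s /\ p = (s * 2 ^ j)%N.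
  have [s] := pfactor_coprime (isT : prime 2) p0.
  by rewrite coprime2n => ? ?; exists (logn 2 p), s.
have hj := shifts_pow2 j oh sh n2 hn.
have := shifts_iter s (iter_odd_stable (2 ^ j) oh) hj x1.
rewrite -iterM -pE px subrr res0 expnS -muln_modl modn2 s1 mul1n => /eqP.
by rewrite eq_sym expn_eq0.
Qed.

(** * Polynomial maps *)

Lemma horner_taylor2 (A : comNzRingType) (p : {poly A}) (x h : A) :
  exists q, p.[x + h] = p.[x] + h * p^`().[x] + h ^+ 2 * q.
Proof.
elim/poly_ind: p => [|p c [q IHp]].
  by exists 0; rewrite deriv0 !horner0; ring.
exists (q * (x + h) + p^`().[x]).
rewrite derivD derivM derivX derivC !hornerE IHp; ring.
Qed.

(** Comparing the hypothesis with the Taylor expansion at x, with increment 4,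
    gives p'(x) = 1 mod 4; the expansion with increment 2 ^ n * z then has its
    quadratic term divisible by 2 ^ n.+2, as n >= 2. *)
Lemma steady_horner (p : {poly Z2}) :
  (forall x, res x 1 = 1%N -> res (p.[x + 4]) 4 = res (p.[x] + 4) 4) ->
  steady (horner p).
Proof.
move=> p4 n y x n2 y1 yx.
have {y1} x1 : res x 1 = 1%N by apply: odd_res_eq yx y1; exact: ltnW.
have [u p'E] : exists u, p^`().[x] = 1 + 4 * u.
  have [q pE] := horner_taylor2 p x 4.
  have /res_subr_eq0 := p4 x x1; rewrite pE.
  have -> : p.[x] + 4 * p^`().[x] + 4 ^+ 2 * q - (p.[x] + 4) =
            2 ^+ 2 * (p^`().[x] - 1 + 4 * q) by ring.
  rewrite (res_pow2M 2 _ 2) => /eqP; rewrite muln_eq0 => /= /eqP.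
  have -> : (4 : Z2) = 2 ^+ 2 by ring.
  rewrite res_addpow2M => /res_eq0P[u uE]; exists u.
  by rewrite -uE; ring.
have [z ->] := res_eqP yx.
have [q ->] := horner_taylor2 p x (2 ^+ n * z).
apply/res_subr_eq0; rewrite p'E.
case: n n2 {yx} => [|[|k]]// _.
have -> : p.[x] + 2 ^+ k.+2 * z * (1 + 4 * u) + (2 ^+ k.+2 * z) ^+ 2 * q
          - (x + 2 ^+ k.+2 * z) - (p.[x] - x) =
          2 ^+ k.+4 * (z * u + 2 ^+ k * z ^+ 2 * q) by rewrite !exprS; ring.
exact: res_pow2M0.
Qed.

(** The hypotheses force p'(0) to be even. *)
Lemma contract_horner (p : {poly Z2}) n x : p.[0] = 0 -> res (p.[2]) 2 = 0%N ->
  (0 < n)%N -> res x n = 0%N -> res (p.[x]) n.+1 = 0%N.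
Proof.
move=> p0 p2 n0 /res_eq0P [z ->].
have [u p'E] : exists u, p^`().[0] = 2 * u.
  have [q pE] := horner_taylor2 p 0 2.
  move: pE p2; rewrite !add0r p0 add0r => ->.
  have -> : 2 * p^`().[0] + 2 ^+ 2 * q =
            2 ^+ 1 * (p^`().[0] + 2 ^+ 1 * q) :> Z2 by ring.
  rewrite (res_pow2M 1 _ 1) => /eqP; rewrite muln_eq0 => /= /eqP.
  by rewrite res_addpow2M => /res_eq0P.
have [q] := horner_taylor2 p 0 (2 ^+ n * z); rewrite add0r p0 p'E => ->.
have -> : 0 + 2 ^+ n * z * (2 * u) + (2 ^+ n * z) ^+ 2 * q =
          2 ^+ n.+1 * (z * u + 2 ^+ (n.-1) * z ^+ 2 * q).
  by case: n n0 {x} => // n _; rewrite !exprS /=; ring.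
exact: res_pow2M0.
Qed.

(** * Fibonacci polynomials modulo powers of 2 *)

Lemma nat_of_binD (a b : N) :
  nat_of_bin (N.add a b) = (nat_of_bin a + nat_of_bin b)%N.
Proof. lia. Qed.

Lemma nat_of_binM (a b : N) :
  nat_of_bin (N.mul a b) = (nat_of_bin a * nat_of_bin b)%N.
Proof. lia. Qed.

Lemma nat_of_bin_mod (a b : N) :
  nat_of_bin (N.modulo a b) = (nat_of_bin a %% nat_of_bin b)%N.
Proof.
have aE := N.div_mod' a b.
case: (eqVneq b 0%num) => [->|b0]; first by case: a {aE}.
have ltb : (nat_of_bin (N.modulo a b) < nat_of_bin b)%N.
  have := N.mod_lt a b; lia.
rewrite [in RHS]aE nat_of_binD nat_of_binM [X in (X + _)%N]mulnC modnMDl.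
by rewrite modn_small.
Qed.

(** The values at x of two consecutive Fibonacci polynomials modulo b, in binary
    arithmetic so that they can be evaluated. *)
Definition fib_pair (b x : N) (m : nat) : N * N :=
  iter m (fun s => (s.2, N.modulo (N.add (N.mul x s.2) s.1) b)) (0%num, 1%num).

Lemma fib_polySS (A : nzRingType) m :
  fib_poly A m.+2 = 'X * fib_poly A m.+1 + fib_poly A m.
Proof. by []. Qed.

Lemma res_fib_pair b n x m : (0 < n)%N -> nat_of_bin b = (2 ^ n)%N ->
  res ((fib_poly Z2 m).[x]) n =
    nat_of_bin (fib_pair b (bin_of_nat (res x n)) m).1 /\
  res ((fib_poly Z2 m.+1).[x]) n =
    nat_of_bin (fib_pair b (bin_of_nat (res x n)) m).2.
Proof.
move=> n0 bE; elim: m => [|m [IHm IHm1]].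
  rewrite /= horner0 hornerC res0; split=> //.
  by rewrite (res_natr 1) modn_small// -{1}(expn0 2) ltn_exp2l.
split=> //; rewrite fib_polySS !hornerE resD resM IHm IHm1 modnDml.
rewrite /fib_pair iterS /= nat_of_bin_mod nat_of_binD nat_of_binM.
by rewrite bin_of_natK bE.
Qed.

Lemma fib_pair_period b x p m q : fib_pair b x p = (0%num, 1%num) ->
  fib_pair b x (m + q * p) = fib_pair b x m.
Proof. by move=> px; rewrite /fib_pair iterD iterM (iter_fix q px). Qed.

(** The residue modulo 2 ^ 8 of F_(124 + 192 d) at an odd point with residue a,
    where e is the parity of d. *)
Definition fib_val (e : bool) (a : nat) : nat :=
  nat_of_bin (fib_pair 256 (bin_of_nat a) (124 + 192 * e)).1.

Definition odd_residues := [seq a <- iota 0 256 | odd a].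

Lemma fib_pair_period384 :
  all (fun a => fib_pair 256 (bin_of_nat a) 384 == (0%num, 1%num)) odd_residues.
Proof. by vm_compute. Qed.

(** The conditions give, in order: F exchanges the classes 1 and 3 modulo 4;
    F' = 1 mod 4; F o F moves points by 2 ^ 7 modulo 2 ^ 8. *)
Lemma fib_val_table e : all (fun a => let v := fib_val e a in [&&
  (a + v) %% 4 == 0, fib_val e ((a + 4) %% 256) %% 16 == (v + 4) %% 16 &
  fib_val e v == (a + 128) %% 256])%N odd_residues.
Proof. by case: e; vm_compute. Qed.

Lemma fib_val_partner e : all (fun k => fib_val e (1 + 4 * k) %% 2 ^ 7 ==
  (51 + 116 * k + 48 * k ^ 2) %% 2 ^ 7)%N (iota 0 32).
Proof. by case: e; vm_compute. Qed.

Lemma mem_odd_residues (x : Z2) : res x 1 = 1%N -> res x 8 \in odd_residues.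
Proof.
move=> x1; rewrite mem_filter mem_iota add0n res_lt andbT.
by have := res_modn x (isT : 1 <= 8)%N; rewrite x1 expn1 modn2; case: odd.
Qed.

Section FibMap.
Variables d m : nat.
Hypothesis mE : m = (124 + 192 * d)%N.
Let F := horner (fib_poly Z2 m).

Lemma res_fib_val x : res x 1 = 1%N -> res (F x) 8 = fib_val (odd d) (res x 8).
Proof.
move=> x1; rewrite /F (@res_fib_pair 256 8 x m isT erefl).1 mE.
rewrite -{1}(odd_double_half d).
have -> : (124 + 192 * (odd d + d./2.*2) = 124 + 192 * odd d + d./2 * 384)%N.
  by lia.
have px : fib_pair 256 (bin_of_nat (res x 8)) 384 = (0%num, 1%num).
  exact: eqP (allP fib_pair_period384 _ (mem_odd_residues x1)).
congr (nat_of_bin _.1).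
exact: fib_pair_period px.
Qed.

Let tableP x (x1 : res x 1 = 1%N) :=
  and3P (allP (fib_val_table (odd d)) _ (mem_odd_residues x1)).

Lemma fib_neg x : res x 1 = 1%N -> res (x + F x) 2 = 0%N.
Proof.
move=> x1; have [/eqP neg _ _] := tableP x1.
by rewrite -(res_modn _ (isT : 2 <= 8)%N) resD modn_dvdm// res_fib_val.
Qed.

Lemma fib_odd_stable : odd_stable F.
Proof.
move=> x x1; have := congr1 (fun a => a %% 2)%N (fib_neg x1).
rewrite resD modn_dvdm// -modnDm !(@res_modn _ 1) ?x1//.
by case: (res1_cases (F x)) => ->.
Qed.

Lemma fib_add4 x : res x 1 = 1%N -> res (F (x + 4)) 4 = res (F x + 4) 4.
Proof.
move=> x1; have [_ /eqP step4 _] := tableP x1.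
have x41 : res (x + 4) 1 = 1%N by rewrite resD x1 (res_natr 4).
have x4 : res (x + 4) 8 = ((res x 8 + 4) %% 256)%N by rewrite resD (res_natr 4).
rewrite -(res_modn _ (isT : 4 <= 8)%N) res_fib_val// x4 step4.
rewrite -(res_modn (F x + 4) (isT : 4 <= 8)%N) resD (res_natr 4) modn_dvdm//.
by rewrite res_fib_val.
Qed.

Lemma fib_shifts : shifts 7 (F \o F).
Proof.
move=> x x1 /=; have [_ _ /eqP inv] := tableP x1.
have FF : res (F (F x)) 8 = res (x + 128) 8.
  rewrite (res_fib_val (fib_odd_stable x1)) (res_fib_val x1) inv.
  by rewrite resD (res_natr 128).
by rewrite resD FF -resD addrC addKr (res_natr 128).
Qed.

Lemma fib_steady : steady F.
Proof. by apply: steady_horner => x; exact: fib_add4. Qed.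

Lemma fib_partner x k : (k < 32)%N -> res x 7 = (1 + 4 * k)%N ->
  res (F x) 7 = ((51 + 116 * k + 48 * k ^ 2) %% 2 ^ 7)%N.
Proof.
move=> k32 xk; pose y : Z2 := (1 + 4 * k)%:R.
have yn n : (7 <= n)%N -> res y n = (1 + 4 * k)%N.
  move=> n7; rewrite res_natr modn_small//.
  by apply: (@leq_trans (2 ^ 7)); [lia|rewrite leq_exp2l].
have y1 : res y 1 = 1%N.
  by rewrite -(@res_modn _ 1 7)// yn// modn2 oddD oddM.
rewrite (@steady_lipschitz F 7 x y) ?yn//; first last.
- by apply: (@odd_res_eq y x 7); rewrite // xk yn.
- exact: fib_steady.
rewrite -(@res_modn _ 7 8)// res_fib_val// yn//.
by apply/eqP/(allP (fib_val_partner (odd d))); rewrite mem_iota.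
Qed.

Lemma fib_at0 : F 0 = 0.
Proof.
have even0 j : (fib_poly Z2 j.*2).[0] = 0.
  elim: j => [|j IHj]; first by rewrite horner0.
  by rewrite doubleS fib_polySS !hornerE.
rewrite /F; have -> : m = (62 + 96 * d)%N.*2 by rewrite mE; lia.
exact: even0.
Qed.

(** Modulo 4 the recurrence at 2 has period 4, and m is divisible by 4. *)
Lemma fib_contract x n : (0 < n)%N -> res x n = 0%N -> res (F x) n.+1 = 0%N.
Proof.
apply: contract_horner; first exact: fib_at0.
rewrite (@res_fib_pair 4 2 2 m isT erefl).1 (res_natr 2).
have -> : m = (0 + (31 + 48 * d) * 4)%N by rewrite mE; lia.
by rewrite fib_pair_period.
Qed.

End FibMap.

(** * Attraction of the even 2-adic integers *)

Section Contraction.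
Variable f : Z2 -> Z2.
Hypothesis fc : forall x n, (0 < n)%N -> res x n = 0%N -> res (f x) n.+1 = 0%N.

Lemma contract_iter x n : res x 1 = 0%N -> res (iter n f x) n.+1 = 0%N.
Proof. by move=> x0; elim: n => //= n IHn; exact: fc. Qed.

Lemma contract_cvg0 x : res x 1 = 0%N -> iter n f x @[n --> \oo] --> (0 : Z2).
Proof.
move=> x0 A /nbhs_Z2P [n nA]; exists n => //= k /= nk.
apply: nA => /=; rewrite res0; apply: (@res_eq0_le _ _ k.+1).
  exact: leqW.
exact: contract_iter.
Qed.

Lemma contract_basin x : res x 1 = 0%N -> attracting_basin R f [set 0] x.
Proof.
move=> x0; rewrite /attracting_basin /=.
rewrite -(@edist_inf0 R Z2 [set 0] 0 erefl).
apply: cvg_comp (contract_cvg0 x0) _.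
exact: edist_inf_continuous.
Qed.

Lemma contract_periodic x p : res x 1 = 0%N -> (0 < p)%N -> iter p f x = x ->
  x = 0.
Proof.
move=> x0 p0 px; apply: Z2_ext => n; rewrite res0.
have xk k : iter (k * p) f x = x by rewrite iterM iter_fix.
rewrite -(xk n); apply: (res_eq0_le _ (contract_iter (n * p) x0)).
by rewrite leqW// leq_pmulr.
Qed.

Lemma contract_at0 : f 0 = 0.
Proof.
apply: Z2_ext => k; rewrite res0; apply: (res_eq0_le (leqW (leqnSn k))).
by apply: fc; rewrite ?res0.
Qed.

(** A minimal component with an even point would contain 0, hence be {0} by
    minimality, which is not open. *)
Lemma contract_minimal N x : minimal_component R f N -> N x -> res x 1 = 1%N.
Proof.
move=> mN Nx; case: (res1_cases x) => // x0.
have iN i y : N y -> N (iter i f y).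
  move=> Ny; elim: i => //= i IHi.
  by apply: (mc_invariant mN); exists (iter i f y).
have [oN clN] := mc_clopen mN.
have N0 : N 0.
  apply: clN; apply/closure_Z2P => n.
  exists (iter n f x); first exact: iN.
  by rewrite res0; apply: (res_eq0_le (leqnSn n)); exact: contract_iter.
have /nbhs_Z2P [n nN] : nbhs (0 : Z2) N by exact: open_nbhs_nbhs.
have := mc_minimal mN N0 (nN (2 ^+ n * 1) _).
rewrite /= res_pow2M0 res0 => /(_ erefl) /closure_Z2P.
move=> /(_ (n + 1)%N) [_ [i _ <-]].
rewrite (iter_fix i contract_at0) res0 res_pow2M (res_natr 1) => /esym/eqP.
by rewrite muln1 expn_eq0.
Qed.

End Contraction.

(** * Minimal components among the odd 2-adic integers *)

Section Components.
Variable f : Z2 -> Z2.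
Hypothesis f_odd : odd_stable f.
Hypothesis f_steady : steady f.
Hypothesis f_shifts : shifts 7 (f \o f).

Lemma odd_aperiodic x p : res x 1 = 1%N -> (0 < p)%N -> iter p f x <> x.
Proof.
move=> x1 p0 px.
have off : odd_stable (f \o f) by move=> y y1; do 2 apply: f_odd.
have st := steady_comp f_odd f_steady f_steady.
apply: (shifts_aperiodic off st _ f_shifts x1 p0) => //.
have -> : f \o f = iter 2 f by [].
by rewrite -iterM mulnC iterM iter_fix.
Qed.

(** For odd r, a ball of radius 2 ^- 7 and the one that f exchanges it with.
    Describing the latter as a preimage makes invariance immediate and needs no
    formula for its centre. *)
Definition component r := [set x : Z2 | res x 1 = 1%N /\
  (res x 7 = r \/ res (f x) 7 = r)].

(** Applying f once if needed brings the orbit into the ball of y, where f \o f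
    has dense orbits. *)
Lemma component_dense r x y k : component r x -> component r y ->
  exists i, res (iter i f x) k = res y k.
Proof.
have off : odd_stable (f \o f) by move=> z z1; do 2 apply: f_odd.
have dense u v : res u 1 = 1%N -> res u 7 = res v 7 ->
    exists i, res (iter i f u) k = res v k.
  move=> u1 uv.
  have st := steady_comp f_odd f_steady f_steady.
  have [i] := shifts_dense off st (isT : 2 <= 7)%N f_shifts u1 uv k.
  have -> : f \o f = iter 2 f by [].
  by rewrite -iterM => iE; exists (i * 2)%N.
have f2 z : res z 1 = 1%N -> res (f (f z)) 7 = res z 7.
  exact: (@res_eq_shift (f \o f)).
have shift z w : (exists i, res (iter i f (f z)) k = w) ->
    exists i, res (iter i f z) k = w.
  by move=> [i iw]; exists i.+1; rewrite iterSr.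
move=> [x1 xr] [y1 yr].
have fx1 := f_odd x1; have fy1 := f_odd y1.
case: xr yr => xr [yr|yr].
- by apply: dense; rewrite ?xr.
- apply: shift; apply: dense => //; rewrite -(f2 y y1).
  by apply: steady_lipschitz => //; rewrite xr.
- by apply: shift; apply: dense => //; rewrite xr.
- apply: dense => //; rewrite -(f2 x x1) -(f2 y y1).
  by apply: steady_lipschitz => //; rewrite xr.
Qed.

Lemma component_stable r x : component r x -> component r (f x).
Proof.
move=> [x1 xr]; split; first exact: f_odd.
case: xr => xr; [right|by left].
by rewrite (res_eq_shift f_shifts x1).
Qed.

Lemma component_orbit r x i : component r x -> component r (iter i f x).
Proof. by move=> xr; elim: i => //= i; exact: component_stable. Qed.

End Components.

Lemma cosetU_balls a b n :
  finite_union_of_balls (Z2_coset a n.+1 `|` Z2_coset b n.+1 : set Z2).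
Proof.
exists [:: (a, 2 ^- n : R); (b, 2 ^- n : R)].
  by move=> ?; rewrite !inE => /orP[]/eqP-> /=; rewrite invr_gt0 exprn_gt0.
rewrite !Z2_cosetE; apply/seteqP; split=> x /=.
  case=> xn; [exists (a, 2 ^- n : R)|exists (b, 2 ^- n : R)];
    by rewrite /= ?inE ?eqxx ?orbT// ball_pow2E.
move=> [c]; rewrite /= !inE => /orP[]/eqP->; rewrite ball_pow2E => xn.
  by left.
by right.
Qed.

Lemma cosetU_clopen a b n : clopen (Z2_coset a n `|` Z2_coset b n : set Z2).
Proof.
rewrite !Z2_cosetE.
exact: (clopen_res n [set r | r = res a n \/ r = res b n]).
Qed.

(** * The decomposition for the Fibonacci polynomial *)

Section FibDecomposition.
Variables d m : nat.
Hypothesis mE : m = (124 + 192 * d)%N.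
Let F := horner (fib_poly Z2 m).
Let M (k : 'I_(2 ^ 5)) :=
  Z2_coset (1 + 4 * k)%:R 7 `|` Z2_coset (51 + 116 * k + 48 * k ^ 2)%:R 7.

Let Fodd : odd_stable F := fib_odd_stable mE.
Let Fst : steady F := fib_steady mE.
Let Fsh : shifts 7 (F \o F) := fib_shifts mE.

Lemma ord_res (k : 'I_(2 ^ 5)) n : (7 <= n)%N ->
  res (1 + 4 * k)%:R n = (1 + 4 * k)%N.
Proof.
move=> n7; rewrite res_natr modn_small//.
by apply: (@leq_trans (2 ^ 7)); [have := ltn_ord k; lia|rewrite leq_exp2l].
Qed.

(** The residue 51 + 116 k + 48 k ^ 2 is that of F (1 + 4 k) modulo 2 ^ 7, and F
    maps it back to 1 + 4 k since F \o F is the identity modulo 2 ^ 7. *)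
Lemma component_fibE k : M k = component F (1 + 4 * k).
Proof.
have k32 : (k < 32)%N := ltn_ord k.
have k1 : res (1 + 4 * k)%:R 1 = 1%N.
  by rewrite -(@res_modn _ 1 7)// ord_res// modn2 oddD oddM.
pose y : Z2 := (1 + 4 * k)%:R.
have y1 : res y 1 = 1%N by [].
have y7 : res y 7 = (1 + 4 * k)%N by exact: ord_res.
have Fy : res (F y) 7 = res (51 + 116 * k + 48 * k ^ 2)%:R 7.
  by rewrite (fib_partner mE k32)// res_natr.
rewrite /M !Z2_cosetE; apply/seteqP; split=> x /=.
  case=> [xk|].
    by split; [exact: (odd_res_eq _ (esym xk))|left; rewrite xk].
  rewrite -Fy => xF; have x1 : res x 1 = 1%N.
    by apply: (odd_res_eq _ (esym xF)) => //; exact: Fodd.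
  split=> //; right.
  by rewrite (steady_lipschitz Fst _ x1 xF)// (@res_eq_shift (F \o F)).
move=> [x1 [xk|xk]]; [by left; rewrite xk y7|right].
rewrite -Fy -(res_eq_shift Fsh x1).
by apply: (@steady_lipschitz F) => //; [exact: Fodd|rewrite xk].
Qed.

Lemma fib_mod4 x : res x 1 = 1%N ->
  res x 2 = 1%N /\ res (F x) 2 = 3%N \/ res x 2 = 3%N /\ res (F x) 2 = 1%N.
Proof.
move=> x1; have := fib_neg mE x1; rewrite resD -/F.
have := @res_modn x 1 2 isT; rewrite x1 modn2.
have := res_lt x 2; have := res_lt (F x) 2.
case: (res x 2) => [|[|[|[|]]]]//; case: (res (F x) 2) => [|[|[|[|]]]]//;
  by [left|right].
Qed.

(** One of x and F x is 1 modulo 4, and the residues 1 + 4 k with k < 32 are all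
    those that are 1 modulo 4 in Z/2^7. *)
Lemma components_cover x : res x 1 = 1%N -> exists k : 'I_(2 ^ 5), M k x.
Proof.
move=> x1.
have idx z : res z 2 = 1%N -> exists k : 'I_(2 ^ 5), res z 7 = (1 + 4 * k)%N.
  move=> z2; have z4 : (res z 7 %% 4 = 1)%N by rewrite (@res_modn z 2 7).
  have zlt : (res z 7 %/ 4 < 2 ^ 5)%N by rewrite ltn_divLR// res_lt.
  by exists (Ordinal zlt); rewrite /= [LHS](divn_eq _ 4) z4 addnC mulnC.
by case: (fib_mod4 x1) => -[x2 Fx2]; [have [k xk] := idx _ x2|
  have [k xk] := idx _ Fx2]; exists k; rewrite component_fibE; split; auto.
Qed.

(** Only one of x and F x is 1 modulo 4, and its residue determines k. *)
Lemma components_disjoint k l x : M k x -> M l x -> k = l.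
Proof.
rewrite !component_fibE => -[x1 xk] [_ xl].
have r2 z (j : 'I_(2 ^ 5)) : res z 7 = (1 + 4 * j)%N -> res z 2 = 1%N.
  by move=> zj; rewrite -(@res_modn z 2 7)// zj addnC mulnC modnMDl.
apply: ord_inj.
case: (fib_mod4 x1) => -[x2 Fx2]; case: xk xl => xk [xl|xl];
  (try by move: (xk) (xl) => /r2 + /r2; rewrite ?x2 ?Fx2);
  by move: xl; rewrite xk; lia.
Qed.

Lemma component_minimal k : minimal_component R F (M k).
Proof.
have cE := component_fibE k.
split.
- by exists (1 + 4 * k)%:R; left; rewrite Z2_cosetE.
- exact: cosetU_clopen.
- exact: cosetU_balls.
- by rewrite cE => _ [x xk <-]; exact: component_stable.
- rewrite cE => x xk y yk; apply/closure_Z2P => n.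
  have [i iE] := component_dense Fodd Fst Fsh n xk yk.
  by exists (iter i F x); [exists i|].
Qed.

(** An orbit starting in the intersection of two minimal components has both of
    them as its closure. *)
Lemma minimal_component_fib N : minimal_component R F N -> exists k, N = M k.
Proof.
move=> mN; have [x Nx] := mc_nonempty mN.
have [k xk] := components_cover (contract_minimal (fib_contract mE) mN Nx).
have MN : closure (forward_orbit F x) = M k.
  apply/seteqP; split; last exact: (mc_minimal (component_minimal k) xk).
  have [_ clM] := mc_clopen (component_minimal k).
  apply: subset_trans clM; apply: closureS => _ [i _ <-].
  by move: xk; rewrite component_fibE; exact: component_orbit.
exists k; apply/seteqP; split; first by rewrite -MN; exact: (mc_minimal mN Nx).
have [_ clN] := mc_clopen mN.
rewrite -MN; apply: subset_trans clN; apply: closureS => _ [i _ <-].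
by elim: i => //= i IHi; apply: (mc_invariant mN); exists (iter i F x).
Qed.

Lemma fib_periodic x p : (0 < p)%N -> iter p F x = x -> x = 0.
Proof.
move=> p0 px; case: (res1_cases x) => x1.
  exact: contract_periodic (fib_contract mE) _ _ x1 p0 px.
by have := odd_aperiodic Fodd Fst Fsh x1 p0 px.
Qed.

End FibDecomposition.

Theorem theorem6p9 (d q m : nat) (hq : q = (10 + 16 * d)%N)
    (hm : m = (4 + 12 * q)%N) :
  let F : Z2 -> Z2 := fun x => (fib_poly Z2 m).[x] in
  let M : 'I_(2 ^ 5) -> set Z2 := fun k =>
    Z2_coset (1 + 4 * k)%:R 7 `|`
    Z2_coset (51 + 116 * k + 48 * k ^ 2)%:R 7 in
  let B : set Z2 := [set 2 * z | z in [set: Z2]] `\` [set 0] in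
  [/\ minimal_decomposition R F [set 0] [set: 'I_(2 ^ 5)] M B,
      F 0 = 0 &
      B `<=` attracting_basin R F [set 0]].
Proof.
have mE : m = (124 + 192 * d)%N by lia.
move=> F M B.
have F0 : F 0 = 0 := contract_at0 (fib_contract mE).
have evenB x : B x -> res x 1 = 0%N.
  by rewrite /B even_setE => -[].
have Bbasin x : B x -> attracting_basin R F [set 0] x.
  by move=> /evenB; exact: contract_basin (fib_contract mE) _.
have M_odd k x : M k x -> res x 1 = 1%N.
  move=> xk; suff: component F (1 + 4 * k)%N x by case.
  by rewrite -(component_fibE mE).
split=> //; split=> //.
- apply/seteqP; split=> // x _.
  case: (res1_cases x) => x1; last first.
    by have [k xk] := components_cover mE x1; left; right; exists k.
  have [x0|/eqP x0] := eqVneq x 0; first by left; left.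
  by right; split=> //; rewrite even_setE.
- apply/seteqP; split=> // x [-> [k _ /M_odd]].
  by rewrite res0.
- by apply/seteqP; split=> // x [-> [_ n0]]; case: n0.
- by apply/seteqP; split=> // x [[k _ /M_odd x1] /evenB]; rewrite x1.
- apply/seteqP; split=> x /=; first by move->; exists 1%N.
  by move=> [p p0 px]; exact: fib_periodic mE _ _ p0 px.
- by move=> k l _ _ [x [xk xl]]; exact: components_disjoint mE _ _ x xk xl.
- apply/seteqP; split=> [_ [k _ <-]|N /(minimal_component_fib mE) [k ->]].
    exact: component_minimal mE k.
  by exists k.
- move=> x /Bbasin xB; exists [set 0] => //; left.
  exists 0; first by exists 1%N.
  apply/seteqP; split=> [_ ->|_ [n _ <-]]; first by exists 0%N.
  by rewrite iter_fix.
Qed.
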